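(* Let $p,q\ge 0$, $C\ge 0$, $\beta>0$, and let $F_0\in[0,1]$ be the initial fraction of adopters. Consider the single-period ($T=1$) Stackelberg game between a policymaker (leader, choosing a rebate $r\ge 0$) and a firm (follower, choosing a price $\pi\ge 0$) described in the context, where $\pi^\star(r)$ denotes the firm's optimal price in response to $r$ and $r^\star$ denotes the policymaker's optimal rebate. For this game, the optimal rebate $r^\star$ is unique. Moreover: (1) Let $$\beta_0=\left(1+W\!\left(e^{p+qF_0-(C+1)}\right)\right)^{-2},$$ where $W$ is the principal branch of the Lambert-W function. When $\beta<\beta_0$, $r^\star>0$; otherwise, $r^\star=0$. (2) Let $$\hat\beta=\left(C+1+e^{p+qF_0}+\left(1+e^{p+qF_0}\right)^2\right)^{-1}.$$ Then, for $\beta>\hat\beta$, $\pi^\star(r^\star)>r^\star$; otherwise, $\pi^\star(r^\star)\le r^\star$. (3) When $r^\star>0$, the final adoption level is greater than in the absence of rebates (i.e. than in the single-period pricing problem without a rebate).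
   Context: For $F\in[0,1]$, $\pi\ge 0$, $r\ge 0$ let $R(F,\pi,r)=\dfrac{e^{p+qF-(\pi-r)}}{1+e^{p+qF-(\pi-r)}}$. Here $p,q$ are the coefficients of innovation and imitation, $C$ is the firm's unit production cost, and $\beta$ is the weight the policymaker puts on reducing the rebate. In the single-period game the final adoption level given $(\pi,r)$ is $F_1=F_0+(1-F_0)R(F_0,\pi,r)$. Given the announced rebate $r$, the firm chooses $\pi^\star(r)$ to maximize its profit $(\pi-C)(1-F_0)R(F_0,\pi,r)$ over $\pi\ge 0$. The policymaker, anticipating this response, chooses $r^\star$ to maximize over $r\ge 0$ the objective $$V^p(F_0,\pi^\star(r),r)=(F_1-F_0)(1-\beta r)=(1-F_0)R\big(F_0,\pi^\star(r),r\big)(1-\beta r).$$ A pair $(\pi^\star(\cdot),r^\star)$ of this kind is a Stackelberg equilibrium. The final adoption level in the game is $F_0+(1-F_0)R(F_0,\pi^\star(r^\star),r^\star)$; in the absence of rebates ($r=0$, with the firm charging $\pi^\star(0)$) it is $F_0+(1-F_0)R(F_0,\pi^\star(0),0)$.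
   Formalization: The initial fraction of adopters is assumed to satisfy 0 ≤ F_0 < 1 instead of F_0 in [0,1]: at F_0 = 1 the profit and the policymaker's objective vanish identically, so every rebate is optimal and r* is not unique. *)

(* Defs.v *)
From Stdlib Require Import Reals ClassicalEpsilon.
Open Scope R_scope.

(* Principal real branch: the solution w >= -1 of w * exp w = x. It exists and
   is unique exactly when x >= - exp (-1); for other x the value is arbitrary. *)
Definition lambertW (x : R) : R :=
  epsilon (inhabits 0) (fun w => -1 <= w /\ w * exp w = x).

Definition adoption_prob (p q F price r : R) : R :=
  exp (p + q * F - (price - r)) / (1 + exp (p + q * F - (price - r))).

Definition final_adoption (p q F0 price r : R) : R :=
  F0 + (1 - F0) * adoption_prob p q F0 price r.

Definition firm_profit (p q C F0 price r : R) : R :=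
  (price - C) * (1 - F0) * adoption_prob p q F0 price r.

Definition policymaker_value (p q beta F0 price r : R) : R :=
  (final_adoption p q F0 price r - F0) * (1 - beta * r).

Definition is_maximizer_nonneg (f : R -> R) (x : R) : Prop :=
  0 <= x /\ forall y, 0 <= y -> f y <= f x.

(* Rebates are nonnegative, so a response is unconstrained at negative [r]. *)
Definition is_best_response (p q C F0 : R) (price_star : R -> R) : Prop :=
  forall r, 0 <= r ->
    is_maximizer_nonneg (fun price => firm_profit p q C F0 price r)
      (price_star r).

Definition is_stackelberg_equilibrium (p q C beta F0 : R)
    (price_star : R -> R) (r_star : R) : Prop :=
  is_best_response p q C F0 price_star /\
  is_maximizer_nonneg
    (fun r => policymaker_value p q beta F0 (price_star r) r) r_star.

Definition beta_zero (p q C F0 : R) : R :=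
  / (1 + lambertW (exp (p + q * F0 - (C + 1)))) ^ 2.

Definition beta_hat (p q C F0 : R) : R :=
  / (C + 1 + exp (p + q * F0) + (1 + exp (p + q * F0)) ^ 2).

(* Main.v *)
Require Import Defs.
From Stdlib Require Import Reals ClassicalEpsilon Lra.
Open Scope R_scope.

(** Put [a = p + q * F0] and let [u = a - (price - r)] be the log-odds of adoption.
    By [1 + x <= exp x], the firm's best response to [r] is the unique price with
    [price = C + 1 + exp u], so that [r = u + exp u + (C + 1 - a)] is strictly
    increasing in [u] and the leader in effect chooses [u].  Her value is then
    proportional to [exp u / (1 + exp u) * (1 - beta * r)], whose derivative in [exp u]
    has the sign of [1 - beta * (r + (1 + exp u) ^ 2)], strictly decreasing in [u].
    Hence the complementary slackness conditions have exactly one solution, which is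
    the strict maximum, and all claims are read off by comparing [u] with the root at
    [r = 0] (part 1) and with [a] (part 2). *)

(** * Equations [x + h x = y] and the Lambert function *)

Lemma id_plus_nondecreasing_surjective (h : R -> R) :
  continuity h -> (forall x y, x <= y -> h x <= h y) -> (forall x, 0 <= h x) ->
  forall y, exists x, x + h x = y.
Proof.
  intros hc hmon hpos y.
  pose proof (hpos y) as hy.
  pose proof (hpos (y - h y)) as hy'.
  assert (hle : h (y - h y) <= h y) by (apply hmon; lra).
  assert (hcont : continuity (fun x => x + h x - y)).
  { change (continuity ((id + h) - fct_cte y)%F).
    apply continuity_minus.
    - apply continuity_plus; [apply derivable_continuous, derivable_id | exact hc].
    - apply continuity_const. intros x z. reflexivity. }
  (* The sign changes on [[y - h y, y]]: the values at the ends are [h (y - h y) - h y <= 0] and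
     [h y >= 0]. *)
  destruct (IVT_cor _ (y - h y) y hcont) as [x [_ hx]].
  - lra.
  - cbv beta. nra.
  - exists x. lra.
Qed.

Lemma exp_le_mono x y : x <= y -> exp x <= exp y.
Proof.
  intros [h | ->]; [left; now apply exp_increasing | right; reflexivity].
Qed.

Lemma id_plus_exp_surjective y : exists x, x + exp x = y.
Proof.
  apply id_plus_nondecreasing_surjective.
  - apply derivable_continuous, derivable_exp.
  - exact exp_le_mono.
  - intros x. left. apply exp_pos.
Qed.

Lemma id_plus_exp_lt x y : x + exp x < y + exp y -> x < y.
Proof.
  intros h. destruct (Rlt_or_le x y) as [hlt | hle]; [exact hlt |].
  pose proof (exp_le_mono _ _ hle). lra.
Qed.

Lemma id_plus_exp_inj x y : x + exp x = y + exp y -> x = y.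
Proof.
  intros h. destruct (Rtotal_order x y) as [hlt | [heq | hlt]]; [| exact heq |];
    pose proof (exp_increasing _ _ hlt); lra.
Qed.

(** Any solution of [w * exp w = exp (u + exp u)] is positive, so logarithms turn the equation into
    [ln w + w = u + exp u], and the left side is injective in [ln w]. *)
Lemma lambertW_exp u : lambertW (exp (u + exp u)) = exp u.
Proof.
  assert (hex : exists w, -1 <= w /\ w * exp w = exp (u + exp u)).
  { exists (exp u). split.
    - pose proof (exp_pos u). lra.
    - now rewrite exp_plus. }
  destruct (epsilon_spec (inhabits 0) _ hex) as [_ hw].
  fold (lambertW (exp (u + exp u))) in hw.
  set (w := lambertW (exp (u + exp u))) in *.
  assert (hpos : 0 < w).
  { pose proof (exp_pos w). pose proof (exp_pos (u + exp u)). nra. }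
  rewrite <- (exp_ln w hpos) in hw |- *.
  rewrite <- exp_plus in hw.
  apply exp_inv in hw.
  now rewrite (id_plus_exp_inj _ _ hw).
Qed.

Lemma beta_zero_eq p q C F0 u0 :
  u0 + exp u0 = p + q * F0 - (C + 1) ->
  beta_zero p q C F0 = / (1 + exp u0) ^ 2.
Proof.
  intros h. unfold beta_zero. now rewrite <- h, lambertW_exp.
Qed.

(** * Tangent-line inequalities and the firm's best price *)

Lemma lt_inv_iff b d : 0 < d -> b < / d <-> b * d < 1.
Proof.
  intros hd. pose proof (Rinv_l d ltac:(lra)) as he. split; intros h.
  - rewrite <- he. now apply Rmult_lt_compat_r.
  - apply (Rmult_lt_reg_r d); [exact hd | lra].
Qed.

Lemma frac_lt a b c d : 0 < b -> 0 < d -> a * d < c * b -> a / b < c / d.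
Proof.
  intros hb hd h. apply (Rmult_lt_reg_r (b * d)); [nra |].
  replace (a / b * (b * d)) with (a * d) by (field; lra).
  replace (c / d * (b * d)) with (c * b) by (field; lra).
  exact h.
Qed.

Lemma exp_tangent_lt m u : m <> u -> (1 + m - u) * exp u < exp m.
Proof.
  intros h. replace m with ((m - u) + u) at 2 by ring. rewrite exp_plus.
  apply Rmult_lt_compat_r; [apply exp_pos |].
  pose proof (exp_ineq1 (m - u) ltac:(lra)). lra.
Qed.

(** The left side is the firm's profit per remaining customer at log-odds [u], when [m] are the
    log-odds at its best price. Multiplied by [1 + exp u], the claim is the tangent bound for [exp]
    at [u]. *)
Lemma logistic_profit_lt m u :
  m <> u -> (1 + m + exp m - u) * (exp u / (1 + exp u)) < exp m.
Proof.
  intros h. pose proof (exp_tangent_lt m u h). pose proof (exp_pos u).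
  apply (Rmult_lt_reg_r (1 + exp u)); [lra |].
  replace ((1 + m + exp m - u) * (exp u / (1 + exp u)) * (1 + exp u))
    with ((1 + m + exp m - u) * exp u) by (field; lra).
  lra.
Qed.

Lemma best_price_iff p q C F0 r price :
  0 <= C -> F0 < 1 ->
  is_maximizer_nonneg (fun x => firm_profit p q C F0 x r) price <->
  price = C + 1 + exp (p + q * F0 - (price - r)).
Proof.
  intros hC hF.
  (* This choice of [m] makes [best = C + 1 + exp m], so the candidate satisfies the first-order
     condition. *)
  destruct (id_plus_exp_surjective (p + q * F0 + r - (C + 1))) as [m hm].
  set (best := p + q * F0 + r - m).
  pose proof (exp_pos m) as hem.
  assert (hbest : p + q * F0 - (best - r) = m) by (unfold best; ring).
  assert (hval : firm_profit p q C F0 best r = (1 - F0) * exp m).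
  { unfold firm_profit, adoption_prob. rewrite hbest.
    replace (best - C) with (1 + exp m) by (unfold best; lra). field. lra. }
  assert (hlt : forall x, x <> best -> firm_profit p q C F0 x r < (1 - F0) * exp m).
  { intros x hx. unfold firm_profit, adoption_prob.
    set (u := p + q * F0 - (x - r)).
    assert (hmu : m <> u) by (intros e; apply hx; unfold u, best in *; lra).
    pose proof (logistic_profit_lt m u hmu) as h.
    replace (x - C) with (1 + m + exp m - u) by (unfold u; lra).
    rewrite (Rmult_comm _ (1 - F0)), Rmult_assoc.
    apply Rmult_lt_compat_l; [lra | exact h]. }
  assert (hbest0 : 0 <= best) by (unfold best; lra).
  split.
  - intros [_ h].
    destruct (Req_dec price best) as [-> | hne].
    + rewrite hbest. unfold best. lra.
    + pose proof (hlt _ hne). specialize (h best hbest0). cbv beta in h. lra.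
  - intros h.
    assert (price = best) as ->.
    { enough (p + q * F0 - (price - r) = m) by (unfold best; lra).
      apply id_plus_exp_inj. lra. }
    split; [exact hbest0 |]. intros y _. rewrite hval.
    destruct (Req_dec y best) as [-> | hne]; [rewrite hval; lra |].
    left. now apply hlt.
Qed.

(** * The policymaker's problem in log-odds *)

Lemma policymaker_value_logodds p q beta F0 price r :
  policymaker_value p q beta F0 price r =
  (1 - F0) * (exp (p + q * F0 - (price - r)) * (1 - beta * r)
              / (1 + exp (p + q * F0 - (price - r)))).
Proof.
  unfold policymaker_value, final_adoption, adoption_prob. field.
  pose proof (exp_pos (p + q * F0 - (price - r))). lra.
Qed.

(** First-order conditions with multiplier for [0 <= r], at log-odds [u]. *)
Definition slackness (beta u r : R) : Prop :=
  0 <= r /\ 1 - beta * r <= beta * (1 + exp u) ^ 2 /\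
  (0 < r -> 1 - beta * r = beta * (1 + exp u) ^ 2).

Lemma slackness_strict_max beta k u r u' r' :
  0 < beta -> r = u + exp u + k -> r' = u' + exp u' + k -> 0 <= r' -> r' <> r ->
  slackness beta u r ->
  exp u' * (1 - beta * r') / (1 + exp u') < exp u * (1 - beta * r) / (1 + exp u).
Proof.
  intros hb hr hr' hr'0 hne (hr0 & hle & heq).
  assert (huu : u <> u') by (intros e; apply hne; now rewrite hr, hr', e).
  pose proof (exp_tangent_lt u u' huu) as ht.
  pose proof (exp_pos u) as hw. pose proof (exp_pos u') as hw'.
  (* Slackness as a variational inequality: the first factor vanishes if [r > 0], and if [r = 0]
     every other feasible rebate has [u' > u]. *)
  assert (hprod : (1 - beta * r - beta * (1 + exp u) ^ 2) * (exp u' - exp u) <= 0).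
  { destruct hr0 as [hr0 | hr0].
    - rewrite (heq hr0). lra.
    - assert (hlt : u < u') by (apply id_plus_exp_lt; lra).
      pose proof (exp_increasing _ _ hlt). nra. }
  apply frac_lt; [lra | lra |].
  replace r' with (r + (u' - u) + (exp u' - exp u)) by lra.
  set (D := 1 - beta * r) in *.
  replace (1 - beta * (r + (u' - u) + (exp u' - exp u)))
    with (D + beta * ((u - u') + (exp u - exp u'))) by (unfold D; ring).
  set (w := exp u) in *. set (v := exp u') in *.
  (* After cross-multiplication, [h1] replaces the term in [u - u']; the resulting bound on the
     difference is [(D - beta * (1 + w) ^ 2) * (v - w) - beta * (1 + w) * (v - w) ^ 2], nonpositive
     by [hprod] and [h2]. *)
  assert (h1 : beta * (1 + w) * (v * (u - u')) < beta * (1 + w) * (w - v)).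
  { apply Rmult_lt_compat_l; [apply Rmult_lt_0_compat; lra | lra]. }
  assert (h2 : 0 <= beta * (1 + w) * (v - w) ^ 2).
  { apply Rmult_le_pos; [apply Rmult_le_pos; lra | apply pow2_ge_0]. }
  nra.
Qed.

(** The case split is on the sign of the marginal value at [u0], the log-odds at zero rebate:
    positive gives an interior solution, otherwise the corner [u0] works. *)
Lemma slackness_exists beta k :
  0 < beta -> exists u, slackness beta u (u + exp u + k).
Proof.
  intros hb.
  destruct (id_plus_exp_surjective (- k)) as [u0 hu0].
  destruct (Rlt_or_le (beta * (1 + exp u0) ^ 2) 1) as [hlt | hle].
  (* This equation is the first-order condition divided by [beta]. *)
  - destruct (id_plus_nondecreasing_surjective
                (fun x => exp x + (1 + exp x) ^ 2)) with (y := / beta - k) as [u hu].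
    + apply derivable_continuous. reg.
    + intros x y hxy. pose proof (exp_le_mono _ _ hxy). pose proof (exp_pos x). nra.
    + intros x. pose proof (exp_pos x). nra.
    + pose proof (Rinv_r beta ltac:(lra)) as hinv.
      assert (hfoc : 1 - beta * (u + exp u + k) = beta * (1 + exp u) ^ 2).
      { replace (/ beta) with (u + (exp u + (1 + exp u) ^ 2) + k) in hinv by lra.
        lra. }
      exists u. split; [| split; [lra | intros _; exact hfoc]].
      (* A negative rebate would give [u < u0], hence [beta * (1 + exp u) ^ 2 < 1], against
         [1 - beta * r > 1]. *)
      destruct (Rle_or_lt 0 (u + exp u + k)) as [h | h]; [exact h |].
      assert (hu' : u < u0) by (apply id_plus_exp_lt; lra).
      pose proof (exp_increasing _ _ hu'). pose proof (exp_pos u).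
      assert ((1 + exp u) ^ 2 <= (1 + exp u0) ^ 2) by nra.
      nra.
  - exists u0. replace (u0 + exp u0 + k) with 0 by lra.
    repeat split; lra.
Qed.

(** * Existence and characterization of equilibria *)

Lemma best_response_exists p q C F0 :
  0 <= C -> F0 < 1 -> exists price_star, is_best_response p q C F0 price_star.
Proof.
  intros hC hF.
  assert (h : forall r, exists price,
    is_maximizer_nonneg (fun x => firm_profit p q C F0 x r) price).
  { intros r.
    destruct (id_plus_exp_surjective (p + q * F0 + r - (C + 1))) as [m hm].
    exists (p + q * F0 + r - m). apply best_price_iff; [exact hC | exact hF |].
    replace (p + q * F0 - (p + q * F0 + r - m - r)) with m by ring. lra. }
  exists (fun r => proj1_sig (constructive_indefinite_description _ (h r))).
  intros r _. apply proj2_sig.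
Qed.

Lemma best_response_logodds p q C F0 price_star r :
  0 <= C -> F0 < 1 -> is_best_response p q C F0 price_star -> 0 <= r ->
  let u := p + q * F0 - (price_star r - r) in
  r = u + exp u + (C + 1 - (p + q * F0)).
Proof.
  intros hC hF hbr hr u.
  pose proof (proj1 (best_price_iff p q C F0 r _ hC hF) (hbr r hr)) as h.
  fold u in h. unfold u at 1. lra.
Qed.

Lemma equilibrium_iff_slackness p q C beta F0 price_star r_star u :
  0 <= C -> 0 < beta -> F0 < 1 ->
  is_best_response p q C F0 price_star ->
  slackness beta u (u + exp u + (C + 1 - (p + q * F0))) ->
  is_stackelberg_equilibrium p q C beta F0 price_star r_star <->
  r_star = u + exp u + (C + 1 - (p + q * F0)).
Proof.
  intros hC hb hF hbr hs.
  set (r := u + exp u + (C + 1 - (p + q * F0))) in *.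
  assert (hr0 : 0 <= r) by apply hs.
  pose proof (best_response_logodds _ _ _ _ _ _ hC hF hbr hr0) as hr.
  (* The firm's response to [r] induces exactly the log-odds [u], so the strict maximum over
     log-odds transfers to rebates. *)
  assert (hlo : p + q * F0 - (price_star r - r) = u).
  { apply id_plus_exp_inj. cbv zeta in hr. unfold r at 1 in hr. lra. }
  assert (hlt : forall y, 0 <= y -> y <> r ->
    policymaker_value p q beta F0 (price_star y) y
    < policymaker_value p q beta F0 (price_star r) r).
  { intros y hy hne. rewrite !policymaker_value_logodds, hlo.
    apply Rmult_lt_compat_l; [lra |].
    apply (slackness_strict_max beta (C + 1 - (p + q * F0))); try assumption.
    - reflexivity.
    - now apply best_response_logodds. }
  split.
  - intros [_ [h0 h]]. destruct (Req_dec r_star r) as [e | hne]; [exact e |].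
    specialize (h r hr0). cbv beta in h. pose proof (hlt _ h0 hne). lra.
  - intros ->. split; [exact hbr |]. split; [exact hr0 |].
    intros y hy. destruct (Req_dec y r) as [-> | hne]; [right; reflexivity |].
    left. now apply hlt.
Qed.

(** * Thresholds in [beta] and the final adoption level *)

Lemma slackness_pos_iff beta k u u0 :
  0 < beta -> u0 + exp u0 + k = 0 -> slackness beta u (u + exp u + k) ->
  0 < u + exp u + k <-> beta * (1 + exp u0) ^ 2 < 1.
Proof.
  intros hb hu0 (hr0 & hle & heq). split.
  - intros hr. specialize (heq hr).
    (* A positive rebate lifts the log-odds above [u0], while the first-order condition keeps
       [beta * (1 + exp u) ^ 2] below 1. *)
    assert (hlt : u0 < u) by (apply id_plus_exp_lt; lra).
    pose proof (exp_increasing _ _ hlt). pose proof (exp_pos u0).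
    assert ((1 + exp u0) ^ 2 <= (1 + exp u) ^ 2) by nra.
    nra.
  - intros h. destruct hr0 as [hr0 | hr0]; [exact hr0 | exfalso].
    assert (u = u0) as -> by (apply id_plus_exp_inj; lra).
    rewrite <- hr0 in hle. lra.
Qed.

(** For [a = p + q * F0], [u < a] means that the price exceeds the rebate. The bracket is
    [r + (1 + exp u) ^ 2] evaluated at [u = a]; for [u >= a] the rebate is positive, so the
    first-order condition is an equality. *)
Lemma slackness_logodds_lt_iff beta C a u :
  0 <= C -> 0 < beta -> slackness beta u (u + exp u + (C + 1 - a)) ->
  u < a <-> 1 < beta * (C + 1 + exp a + (1 + exp a) ^ 2).
Proof.
  intros hC hb (hr0 & hle & heq).
  pose proof (exp_pos u) as hw. pose proof (exp_pos a) as hs. split.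
  - intros h. pose proof (exp_increasing _ _ h).
    assert ((1 + exp u) ^ 2 < (1 + exp a) ^ 2) by nra.
    assert (hlt : u + exp u + (C + 1 - a) + (1 + exp u) ^ 2
                  < C + 1 + exp a + (1 + exp a) ^ 2) by lra.
    apply (Rmult_lt_compat_l beta) in hlt; lra.
  - intros h. destruct (Rlt_or_le u a) as [hlt | hge]; [exact hlt | exfalso].
    pose proof (exp_le_mono _ _ hge).
    assert (hr : 0 < u + exp u + (C + 1 - a)) by lra.
    specialize (heq hr).
    assert ((1 + exp a) ^ 2 <= (1 + exp u) ^ 2) by nra.
    assert (hl : C + 1 + exp a + (1 + exp a) ^ 2
                 <= u + exp u + (C + 1 - a) + (1 + exp u) ^ 2) by lra.
    apply (Rmult_le_compat_l beta) in hl; lra.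
Qed.

Lemma final_adoption_lt p q F0 price r price' r' :
  F0 < 1 -> price' - r' < price - r ->
  final_adoption p q F0 price r < final_adoption p q F0 price' r'.
Proof.
  intros hF h. unfold final_adoption, adoption_prob.
  apply Rplus_lt_compat_l, Rmult_lt_compat_l; [lra |].
  pose proof (exp_increasing (p + q * F0 - (price - r))
                (p + q * F0 - (price' - r')) ltac:(lra)).
  pose proof (exp_pos (p + q * F0 - (price - r))).
  apply frac_lt; lra.
Qed.

(** The bound [F0 < 1] is strict because at [F0 = 1] profit and value vanish identically, making
    every nonnegative rebate optimal. *)
Theorem theorem3 (p q C beta F0 : R)
    (hp : 0 <= p) (hq : 0 <= q) (hC : 0 <= C) (hbeta : 0 < beta)
    (hF0 : 0 <= F0) (hF0' : F0 < 1) :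
  (exists! r_star : R, exists price_star : R -> R,
      is_stackelberg_equilibrium p q C beta F0 price_star r_star) /\
  (forall (price_star : R -> R) (r_star : R),
      is_stackelberg_equilibrium p q C beta F0 price_star r_star ->
      ((beta < beta_zero p q C F0 -> 0 < r_star) /\
       (~ beta < beta_zero p q C F0 -> r_star = 0)) /\
      ((beta > beta_hat p q C F0 -> price_star r_star > r_star) /\
       (~ beta > beta_hat p q C F0 -> price_star r_star <= r_star)) /\
      (0 < r_star ->
         final_adoption p q F0 (price_star r_star) r_star >
         final_adoption p q F0 (price_star 0) 0)).
Proof.
  destruct (slackness_exists beta (C + 1 - (p + q * F0)) hbeta) as [u hs].
  pose proof (fun ps rs hbr =>
    equilibrium_iff_slackness p q C beta F0 ps rs u hC hbeta hF0' hbr hs) as heq.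
  split.
  - destruct (best_response_exists p q C F0 hC hF0') as [ps hps].
    exists (u + exp u + (C + 1 - (p + q * F0))). split.
    + exists ps. now apply heq.
    (* The log-odds [u] were fixed before any response function, so different responses yield the
       same rebate. *)
    + intros r' [ps' h]. symmetry. apply (heq ps'); [apply h | exact h].
  - intros ps r h. pose proof (proj1 h) as hbr.
    apply (heq ps r hbr) in h.
    assert (hr0 : 0 <= r) by (rewrite h; apply hs).
    pose proof (best_response_logodds _ _ _ _ _ _ hC hF0' hbr hr0) as hu.
    cbv zeta in hu.
    assert (hlo : p + q * F0 - (ps r - r) = u) by (apply id_plus_exp_inj; lra).
    pose proof (best_response_logodds _ _ _ _ _ _ hC hF0' hbr (Rle_refl 0)) as hu0.
    cbv zeta in hu0.
    set (u0 := p + q * F0 - (ps 0 - 0)) in *.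
    split; [| split].
    + rewrite (beta_zero_eq p q C F0 u0) by lra.
      pose proof (exp_pos u0).
      pose proof (slackness_pos_iff beta _ u u0 hbeta (eq_sym hu0) hs) as hpos.
      rewrite <- h in hpos.
      rewrite lt_inv_iff by nra. rewrite <- hpos.
      split; [easy | intros hn; lra].
    + pose proof (slackness_logodds_lt_iff beta C _ u hC hbeta hs) as hlt.
      pose proof (exp_pos (p + q * F0)).
      set (d := C + 1 + exp (p + q * F0) + (1 + exp (p + q * F0)) ^ 2) in *.
      assert (hd : 0 < d) by (unfold d; nra).
      assert (hhat : beta > beta_hat p q C F0 <-> 1 < beta * d).
      { unfold beta_hat. fold d. pose proof (Rinv_l d ltac:(lra)) as hinv. split.
        - intros hg. rewrite <- hinv. now apply Rmult_lt_compat_r.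
        - intros hg. apply (Rmult_lt_reg_r d); lra. }
      rewrite hhat, <- hlt. split; intros; lra.
    + intros hr. apply final_adoption_lt; [exact hF0' |].
      (* The rebate is increasing in the log-odds, so [r > 0] forces a lower net price than at zero
         rebate. *)
      assert (hlt : u0 < u) by (apply id_plus_exp_lt; lra).
      unfold u0 in hlt. lra.
Qed.
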